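(* Let $m\leqslant n$, let $A,H\in\mathbb{R}^{n\times n}$ and $Q\in\mathbb{R}^{m\times m}$ be symmetric positive definite matrices, and let $B\in\mathbb{R}^{m\times n}$ be rank-deficient. Then all the nonzero eigenvalues $\lambda$ with nonzero imaginary part of the preconditioned matrix $\mathcal{K}^{-1}\mathcal{A}$ are located in the disc centered at $(1,0)$ (i.e. at $1\in\mathbb{C}$) with radius $\sqrt{\frac{\lambda_{\max}(H)}{\lambda_{\max}(H)+\lambda_{\min}(A)}}$, that is, $$|\lambda-1|\leqslant\sqrt{\frac{\lambda_{\max}(H)}{\lambda_{\max}(H)+\lambda_{\min}(A)}}.$$
   Context: ''$B$ is rank-deficient'' means $\mathrm{rank}(B)<m\leqslant n$. Define $$\mathcal{A}=\begin{pmatrix}A & B^T\\ -B & 0\end{pmatrix},\qquad \mathcal{K}=\begin{pmatrix}H&0\\0&Q\end{pmatrix}+\mathcal{A}=\begin{pmatrix}H+A & B^T\\ -B & Q\end{pmatrix},$$ where $\mathcal{K}$ is nonsingular. $\lambda_{\min}(\cdot)$ and $\lambda_{\max}(\cdot)$ denote the smallest and largest eigenvalues of a symmetric matrix. *)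

(* Defs.v *)
From mathcomp Require Import all_boot all_order all_algebra.
From mathcomp Require Import polyrcf complex.

Set Implicit Arguments.
Unset Strict Implicit.
Unset Printing Implicit Defensive.

Import Order.TTheory GRing.Theory Num.Theory.
Local Open Scope ring_scope.

Definition spd (R : rcfType) (n : nat) (M : 'M[R]_n) : Prop :=
  (M \is symmetricmx) /\
  (forall x : 'cV[R]_n, x != 0 -> 0 < (x^T *m M *m x) 0 0).

(* [rootsR p] is the increasing list of the roots of [p] in [R], so these are
   the smallest and largest elements of the real spectrum.  The default value
   0 is irrelevant for a symmetric matrix of positive size; see [lambda_minP]
   and [lambda_maxP]. *)
Definition lambda_min (R : rcfType) (n : nat) (M : 'M[R]_n) : R :=
  head 0 (rootsR (char_poly M)).

Definition lambda_max (R : rcfType) (n : nat) (M : 'M[R]_n) : R :=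
  last 0 (rootsR (char_poly M)).

Definition calA (R : rcfType) (m n : nat) (A : 'M[R]_n) (B : 'M[R]_(m, n)) :
    'M[R]_(n + m) :=
  block_mx A B^T (- B) 0.

Definition calK (R : rcfType) (m n : nat) (A H : 'M[R]_n) (Q : 'M[R]_m)
    (B : 'M[R]_(m, n)) : 'M[R]_(n + m) :=
  block_mx H 0 0 Q + calA A B.

(* The spectrum of a real matrix is taken over the complex numbers. *)
Definition complex_mx (R : rcfType) (n : nat) (M : 'M[R]_n) : 'M[R[i]]_n :=
  map_mx (real_complex R) M.

Lemma calK_block (R : rcfType) (m n : nat) (A H : 'M[R]_n) (Q : 'M[R]_m)
    (B : 'M[R]_(m, n)) :
  calK A H Q B = block_mx (H + A) B^T (- B) Q.
Proof. by rewrite /calK /calA add_block_mx !add0r addr0. Qed.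

Lemma mem_rootsR_char_poly (R : rcfType) (n : nat) (M : 'M[R]_n) (a : R) :
  (a \in rootsR (char_poly M)) = eigenvalue M a.
Proof.
have p0 : char_poly M != 0 by rewrite monic_neq0 ?char_poly_monic.
by have /(_ a) := roots_on_rootsR p0; rewrite in_itv /= eigenvalue_root_char => <-.
Qed.

Lemma sym_eigenvalue_exists (R : rcfType) (n : nat) (M : 'M[R]_n) :
  (0 < n)%N -> M \is symmetricmx -> exists a : R, eigenvalue M a.
Proof.
move=> n0 /is_hermitianmxP; rewrite expr0 scale1r map_mx_id // => sM.
pose C := complex_mx M.
have /closed_rootP [l] : size (char_poly C) != 1%N.
  by rewrite size_char_poly eqSS -lt0n.
rewrite -eigenvalue_root_char => /eigenvalueP [v vC v0].
have CT : (map_mx Num.conj C)^T = C.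
  apply/matrixP => i j; rewrite !mxE [in RHS]sM mxE.
  by apply/eqP; rewrite eq_complex /= oppr0 !eqxx.
pose w := (map_mx Num.conj v)^T.
have Cw : C *m w = l^* *: w.
  by rewrite -{1}CT -trmx_mul -map_mxM vC map_mxZ linearZ.
have vw : (v *m w) 0 0 != 0.
  have /rV0Pn [j vj] := v0.
  rewrite mxE psumr_neq0 => [|i _]; last by rewrite !mxE mul_conjC_ge0.
  by apply/hasP; exists j; rewrite ?mem_index_enum //= !mxE mul_conjC_gt0.
have ll : l = l^*.
  have /matrixP/(_ 0 0) := mulmxA v C w.
  by rewrite Cw vC -scalemxAl -scalemxAr [LHS]mxE [RHS]mxE => /(mulIf vw).
have lR : real_complex R (complex.Re l) = l by apply: RRe_real; apply/CrealP.
exists (complex.Re l).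
rewrite eigenvalue_root_char -(fmorph_root (real_complex R)) map_char_poly.
rewrite -lR in vC.
by rewrite -/(complex_mx M) -eigenvalue_root_char; apply/eigenvalueP; exists v.
Qed.

Lemma lambda_minP (R : rcfType) (n : nat) (M : 'M[R]_n) :
  (0 < n)%N -> M \is symmetricmx ->
  eigenvalue M (lambda_min M) /\
  (forall a, eigenvalue M a -> lambda_min M <= a).
Proof.
move=> n0 sM; have [a] := sym_eigenvalue_exists n0 sM.
have := mem_rootsR_char_poly M; rewrite /lambda_min.
have : sorted <%R (rootsR (char_poly M)) by exact: sorted_roots.
case: (rootsR _) => [|b s] /= srt E; first by rewrite -E.
move=> _; split; first by rewrite -E mem_head.
move=> c; rewrite -E inE => /predU1P [-> //|cs].
by move: srt; rewrite (path_sortedE lt_trans) => /andP[/allP/(_ _ cs)/ltW].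
Qed.

Lemma lambda_maxP (R : rcfType) (n : nat) (M : 'M[R]_n) :
  (0 < n)%N -> M \is symmetricmx ->
  eigenvalue M (lambda_max M) /\
  (forall a, eigenvalue M a -> a <= lambda_max M).
Proof.
move=> n0 sM; have [a] := sym_eigenvalue_exists n0 sM.
have := mem_rootsR_char_poly M; rewrite /lambda_max.
have : sorted <%R (rootsR (char_poly M)) by exact: sorted_roots.
elim/last_ind: (rootsR _) => [|s b _] srt E; first by rewrite -E.
rewrite last_rcons => _; split; first by rewrite -E mem_rcons mem_head.
move=> c; rewrite -E mem_rcons inE => /predU1P [-> //|cs].
move: srt; rewrite sorted_pairwise; last exact: lt_trans.
by rewrite pairwise_rcons => /andP[/allP/(_ _ cs)/ltW].
Qed.

(* Main.v *)
Require Import Defs.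
From mathcomp Require Import all_boot all_order all_algebra.
From mathcomp Require Import complex.
From mathcomp Require Import ring.

Set Implicit Arguments.
Unset Strict Implicit.

Import Order.TTheory GRing.Theory Num.Theory.
Local Open Scope ring_scope.

(** A left eigenvector of [calK^-1 calA] yields a row vector [(x, y)] with
    [(1 - lambda) (x, y) calA = lambda (x, y) diag(H, Q)].  Pairing its two blocks
    with [x^*] and [y^*] and eliminating the coupling term [y B x^*] gives
    [`|1 - lambda|^2 a = lambda (1 - lambda)^* h + lambda^* (1 - lambda) q],
    where [a], [h], [q] are the values at [x], [x], [y] of the Hermitian forms of
    [A], [H], [Q].  For a non-real [lambda] the imaginary part forces [h = q],
    whence [`|1 - lambda|^2 (h + a) = (1 - `|lambda|^2) h <= h], and Rayleigh
    quotients bound [h / (h + a)]. *)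

(** Arguments are row vectors since [eigenvalue] refers to left eigenvectors; the form is
    conjugate-linear in [y]. *)
Definition sesq (C : numClosedFieldType) (p n : nat)
    (x : 'rV[C]_p) (M : 'M[C]_(p, n)) (y : 'rV[C]_n) : C :=
  (x *m M *m map_mx Num.conj y^T) 0 0.

Lemma conj_map_real_complex (R : rcfType) (m n : nat) (M : 'M[R]_(m, n)) :
  map_mx Num.conj (map_mx (real_complex R) M) = map_mx (real_complex R) M.
Proof.
by apply/matrixP => i j; rewrite !mxE; apply/CrealP/complex_realP; exists (M i j).
Qed.

Lemma sesq_conj (R : rcfType) (p n : nat) (x : 'rV[R[i]]_p)
    (M : 'M[R]_(p, n)) (y : 'rV[R[i]]_n) :
  (sesq x (map_mx (real_complex R) M) y)^* =
  sesq y (map_mx (real_complex R) M^T) x.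
Proof.
rewrite /sesq.
have -> : forall N : 'M[R[i]]_1, (N 0 0)^* = (map_mx Num.conj N)^T 0 0.
  by move=> N; rewrite !mxE.
rewrite !map_mxM !trmx_mul conj_map_real_complex -!map_trmx trmxK mulmxA.
by rewrite -map_mx_comp (map_mx_id (@conjCK _)).
Qed.

(** Unitary diagonalisation over [R[i]] turns both forms into sums of squared moduli of coordinates,
    the second one weighted by the eigenvalues. For [n = 0] the sums are empty. *)
Lemma rayleigh_bounds (R : rcfType) (n : nat) (M : 'M[R]_n) (x : 'rV[R[i]]_n) :
  M \is symmetricmx ->
  real_complex R (lambda_min M) * sesq x 1%:M x <= sesq x (complex_mx M) x /\
  sesq x (complex_mx M) x <= real_complex R (lambda_max M) * sesq x 1%:M x.
Proof.
move=> sM; set C := complex_mx M.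
have hC : C \is hermsymmx.
  apply: realsym_hermsym.
    apply/is_hermitianmxP; rewrite expr0 scale1r map_mx_id //.
    have /is_hermitianmxP := sM; rewrite expr0 scale1r map_mx_id // => MT.
    by rewrite /C /complex_mx {1}MT map_trmx.
  by apply/mxOverP => i j; rewrite mxE; apply/complex_realP; exists (M i j).
have rsp := hermitian_spectral_diag_real hC.
have /hermitian_normalmx /orthomx_spectralP := hC.
have uP := spectral_unit C; have := spectral_unitarymx C.
set P := spectralmx C; set d := spectral_diag C => PU CE.
(* Row [j] of [P] is a left eigenvector for [d 0 j]. This value is real, so it descends to an
   eigenvalue of [M] over [R], where the extremal bounds apply. *)
have dE j : exists2 r, d 0 j = real_complex R r &
    lambda_min M <= r <= lambda_max M.
  have n0 : (0 < n)%N by case: (n) j => [[]|].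
  have /complex_realP[r dr] : d 0 j \is Num.real by have /mxOverP := rsp; apply.
  exists r => //.
  have ev : eigenvalue M r.
    rewrite -(eigenvalue_map (real_complex R)); apply/eigenvalueP.
    exists (row j P).
      rewrite -row_mul -[map_mx _ _]/C [in P *m _]CE !mulmxA mulmxV // mul1mx.
      rewrite mul_diag_mx; apply/rowP => k; rewrite !mxE.
      by rewrite dr.
    apply: contraTneq uP => Pj0; rewrite -row_free_unit; apply/row_freePn.
    by exists j; rewrite Pj0 sub0mx.
  by rewrite (proj2 (lambda_minP n0 sM) _ ev) (proj2 (lambda_maxP n0 sM) _ ev).
pose y := x *m invmx P.
have xE : x = y *m P by rewrite mulmxKV.
have PP : P *m map_mx Num.conj P^T = 1%:M by apply/unitarymxP.
have S1 : sesq x 1%:M x = \sum_j `|y 0 j| ^+ 2.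
  rewrite /sesq mulmx1 {1 2}xE trmx_mul map_mxM !mulmxA -(mulmxA y) PP mulmx1 mxE.
  by apply: eq_bigr => j _; rewrite !mxE normCK.
have S2 : sesq x C x = \sum_j d 0 j * `|y 0 j| ^+ 2.
  rewrite /sesq {1}CE {1 2}xE trmx_mul map_mxM !mulmxA -(mulmxA y) mulmxV // mulmx1.
  rewrite -(mulmxA _ P) PP mulmx1 mul_mx_diag mxE.
  by apply: eq_bigr => j _; rewrite !mxE normCK [X in X * _]mulrC -mulrA.
rewrite S1 S2 !mulr_sumr; split; apply: ler_sum => j _;
  have [r -> /andP[r1 r2]] := dE j; by rewrite ler_wpM2r ?exprn_ge0 // lecR.
Qed.

Lemma sesq1_ge0 (C : numClosedFieldType) (n : nat) (x : 'rV[C]_n) :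
  0 <= sesq x 1%:M x.
Proof.
rewrite /sesq mulmx1 mxE sumr_ge0 // => j _.
by rewrite !mxE mul_conjC_ge0.
Qed.

Lemma sesq1_eq0 (C : numClosedFieldType) (n : nat) (x : 'rV[C]_n) :
  (sesq x 1%:M x == 0) = (x == 0).
Proof.
apply/eqP/eqP => [|->]; last by rewrite /sesq !mul0mx mxE.
rewrite /sesq mulmx1 mxE => /psumr_eq0P x0; apply/rowP => j.
have /eqP : x 0 j * map_mx Num.conj x^T j 0 = 0.
  by apply: x0 => // k _; rewrite !mxE mul_conjC_ge0.
by rewrite !mxE mul_conjC_eq0 => /eqP.
Qed.

Lemma spd_lambda_min_gt0 (R : rcfType) (n : nat) (M : 'M[R]_n) :
  (0 < n)%N -> spd M -> 0 < lambda_min M.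
Proof.
move=> n0 [sM pM]; have [/eigenvalueP[v vM v0] _] := lambda_minP n0 sM.
have := pM v^T; rewrite trmx_eq0 trmxK => /(_ v0).
rewrite vM -scalemxAl mxE pmulr_lgt0 // mxE.
have [j vj] := rV0Pn _ v0.
rewrite lt_def psumr_neq0 ?sumr_ge0 => [|i _|i _];
  rewrite ?mxE -?expr2 ?sqr_ge0 // andbT.
apply/hasP; exists j; rewrite ?mem_index_enum //= mxE -expr2.
by rewrite lt_def sqr_ge0 sqrf_eq0 vj.
Qed.

(** [spd] only tests real vectors; the Rayleigh lower bound carries positivity over to complex
    ones. *)
Lemma sesq_spd_ge0 (R : rcfType) (n : nat) (M : 'M[R]_n) (x : 'rV[R[i]]_n) :
  spd M -> 0 <= sesq x (complex_mx M) x.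
Proof.
case: n M x => [|n] M x hM; first by rewrite /sesq thinmx0 !mul0mx mxE.
have [lM _] := rayleigh_bounds x (proj1 hM); apply: (le_trans _ lM).
by rewrite mulr_ge0 ?sesq1_ge0 // ler0c ltW ?spd_lambda_min_gt0.
Qed.

Lemma sesq_spd_eq0 (R : rcfType) (n : nat) (M : 'M[R]_n) (x : 'rV[R[i]]_n) :
  spd M -> sesq x (complex_mx M) x = 0 -> x = 0.
Proof.
case: n M x => [|n] M x hM; first by rewrite thinmx0.
have l0 := spd_lambda_min_gt0 (ltn0Sn n) hM => x0; apply/eqP; rewrite -sesq1_eq0.
rewrite eq_le sesq1_ge0 andbT -(pmulr_rle0 _ (_ : 0 < real_complex R (lambda_min M))).
  by rewrite -x0; have [] := rayleigh_bounds x (proj1 hM).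
by rewrite ltcR.
Qed.

Lemma saddle_scalar_bound (C : numClosedFieldType) (l a h q s : C) :
  l^* != l -> a \is Num.real -> 0 <= h -> q \is Num.real ->
  (1 - l) * (a - s) = l * h -> (1 - l) * s^* = l * q ->
  h = q /\ `|1 - l| ^+ 2 * (h + a) <= h.
Proof.
move=> ll aR h0 qR E1 E2.
have [aC hC qC] : [/\ a^* = a, h^* = h & q^* = q].
  by split; apply/CrealP => //; exact: ger0_real.
have E3 : (1 - l^*) * s = l^* * q.
  by rewrite -[in RHS]qC -rmorphM -E2 rmorphM rmorphB rmorph1 /= conjCK.
(* The first equation times [1 - l^*] plus the conjugated second times [1 - l]: the coupling term
   [s] cancels. *)
have E4 : (1 - l) * (1 - l^*) * a = l * (1 - l^*) * h + l^* * (1 - l) * q.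
  have -> : (1 - l) * (1 - l^*) * a =
      (1 - l^*) * ((1 - l) * (a - s)) + (1 - l) * ((1 - l^*) * s) by ring.
  by rewrite E1 E3; ring.
have E5 : (1 - l) * (1 - l^*) * a = l^* * (1 - l) * h + l * (1 - l^*) * q.
  move/(congr1 Num.conj): E4.
  rewrite !(rmorphD, rmorphM, rmorphN, rmorph1) /= !conjCK aC hC qC.
  by move=> <-; ring.
have hq : h = q.
  apply/eqP; rewrite -subr_eq0.
  have : (l - l^*) * (h - q) == 0.
    have -> : (l - l^*) * (h - q) = l * (1 - l^*) * h + l^* * (1 - l) * q -
        (l^* * (1 - l) * h + l * (1 - l^*) * q) by ring.
    by rewrite -E4 -E5 subrr.
  by rewrite mulf_eq0 (subr_eq0 l) (eq_sym l) (negPf ll).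
split=> //.
have -> : `|1 - l| ^+ 2 * (h + a) = (1 - `|l| ^+ 2) * h.
  rewrite !normCK rmorphB rmorph1 /= mulrDr E4 -hq; ring.
by rewrite mulrBl mul1r gerBl mulr_ge0 ?exprn_ge0.
Qed.

(** The quotient [h / (h + a)] grows with [h] and decreases with [a], so it is at most its value at
    [h = L * N], [a = l * N], where [N] cancels. With denominators cleared this is
    [h * l <= L * N * l <= L * a]. *)
Lemma norm_quotient_bound (F : numFieldType) (t a h N l L : F) :
  0 < l -> 0 < L -> 0 < N -> 0 < h ->
  t * (h + a) <= h -> l * N <= a -> h <= L * N -> t <= L / (L + l).
Proof.
move=> l0 L0 N0 h0 bnd la hL.
have a0 : 0 < a by apply: lt_le_trans la; apply: mulr_gt0.
rewrite ler_pdivlMr ?addr_gt0 // -(ler_pM2r (addr_gt0 h0 a0)).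
rewrite mulrAC; apply: le_trans (ler_wpM2r (ltW (addr_gt0 L0 l0)) bnd) _.
rewrite !mulrDr mulrC lerD2l; apply: le_trans (ler_wpM2r (ltW l0) hL) _.
by rewrite -mulrA ler_pM2l // mulrC.
Qed.

Theorem theorem4 (R : rcfType) (m n : nat) (hmn : (m <= n)%N)
    (A H : 'M[R]_n) (Q : 'M[R]_m) (B : 'M[R]_(m, n))
    (hA : spd A) (hH : spd H) (hQ : spd Q)
    (hB : (\rank B < m)%N)
    (hK : calK A H Q B \in unitmx)
    (lambda : R[i])
    (hlambda : eigenvalue (complex_mx (invmx (calK A H Q B) *m calA A B)) lambda)
    (hlambda0 : lambda != 0)
    (hIm : complex.Im lambda != 0) :
  `|lambda - 1| <=
    real_complex R (Num.sqrt (lambda_max H / (lambda_max H + lambda_min A))).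
Proof.
(* A rank strictly below [m] makes [m] positive, hence [n] too. *)
have n0 : (0 < n)%N by apply: leq_trans hmn; apply: leq_ltn_trans hB.
have ll : lambda^* != lambda.
  by apply: contra hIm => /eqP/CrealP/complex_realP[r ->].
have [v vE v0] := eigenvalueP hlambda.
(* This substitution removes the inverse: [w] solves the generalized problem
   [w calA = lambda w calK]. *)
pose w := v *m invmx (complex_mx (calK A H Q B)).
have uK : complex_mx (calK A H Q B) \in unitmx by rewrite map_unitmx.
have w0 : w != 0.
  by apply: contraNneq v0 => w0; rewrite -[v](mulmxKV uK) -/w w0 mul0mx.
have wE : (1 - lambda) *: (w *m complex_mx (calA A B)) =
          lambda *: (w *m complex_mx (block_mx H 0 0 Q)).
  have : w *m complex_mx (calA A B) = lambda *: (w *m complex_mx (calK A H Q B)).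
    by rewrite mulmxKV // -vE /w /complex_mx map_mxM map_invmx mulmxA.
  rewrite /calK /complex_mx map_mxD mulmxDr scalerDr => E.
  by rewrite scalerBl scale1r {1}E addrK.
pose x := lsubmx w; pose y := rsubmx w.
have wxy : w = row_mx x y by rewrite hsubmxK.
(* The two block columns read [(1 - lambda) (x A - y B) = lambda x H] and
   [(1 - lambda) x B^T = lambda y Q]. *)
move: wE; rewrite wxy /calA /complex_mx !map_block_mx !mul_row_block !map_mx0.
rewrite !mulmx0 !scale_row_mx addr0 add0r addr0 => /eq_row_mx[Ex Ey].
set cA := map_mx _ A in Ex; set cH := map_mx _ H in Ex; set cQ := map_mx _ Q in Ey.
have Eh : (1 - lambda) * (sesq x cA x - sesq y (map_mx (real_complex R) B) x) =
          lambda * sesq x cH x.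
  move/(congr1 (fun u => (u *m map_mx Num.conj x^T) 0 0)): Ex.
  by rewrite /sesq -!scalemxAl mulmxDl map_mxN mulmxN mulNmx !mxE.
have Eq : (1 - lambda) * (sesq y (map_mx (real_complex R) B) x)^* =
          lambda * sesq y cQ y.
  rewrite sesq_conj.
  move/(congr1 (fun u => (u *m map_mx Num.conj y^T) 0 0)): Ey.
  by rewrite /sesq -!scalemxAl !mxE.
have [hq bnd] := saddle_scalar_bound ll (ger0_real (sesq_spd_ge0 x hA))
  (sesq_spd_ge0 x hH) (ger0_real (sesq_spd_ge0 y hQ)) Eh Eq.
(* If [h] vanished, so would [q = h]; definiteness of [H] and [Q] would then give [x = 0] and
   [y = 0], against [w != 0]. *)
have h0 : sesq x cH x != 0.
  apply: contraNneq w0 => h0; rewrite wxy.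
  rewrite (sesq_spd_eq0 hH h0) (sesq_spd_eq0 (x := y) hQ) ?row_mx0 //.
  by rewrite -hq.
have x0 : x != 0.
  by apply: contraNneq h0 => ->; rewrite /sesq !mul0mx mxE.
have N0 : 0 < sesq x 1%:M x by rewrite lt_def sesq1_eq0 x0 sesq1_ge0.
have [la _] := rayleigh_bounds x (proj1 hA).
have [_ hL] := rayleigh_bounds x (proj1 hH).
rewrite -/cA -/cH in la hL bnd.
have hpos : 0 < sesq x cH x by rewrite lt_def h0 sesq_spd_ge0.
have l0 : 0 < lambda_min A by exact: spd_lambda_min_gt0.
(* Follows from [0 < h <= lambda_max H * N] with [N > 0] the squared norm of [x]. *)
have L0 : 0 < lambda_max H.
  by rewrite -ltcR -(pmulr_lgt0 _ N0); apply: lt_le_trans hL.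
have sq0 : 0 <= lambda_max H / (lambda_max H + lambda_min A).
  by rewrite divr_ge0 // ?addr_ge0 // ltW.
have sqE :
    real_complex R (Num.sqrt (lambda_max H / (lambda_max H + lambda_min A))) ^+ 2 =
    real_complex R (lambda_max H) /
      (real_complex R (lambda_max H) + real_complex R (lambda_min A)).
  by rewrite -rmorphXn /= sqr_sqrtr // fmorph_div rmorphD.
have sq_bound : `|1 - lambda| ^+ 2 <=
    real_complex R (Num.sqrt (lambda_max H / (lambda_max H + lambda_min A))) ^+ 2.
  by rewrite sqE; apply: norm_quotient_bound N0 hpos bnd la hL; rewrite ltcR.
by rewrite distrC -ler_sqr ?nnegrE ?normr_ge0 ?ler0c ?sqrtr_ge0.
Qed.
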